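(* Let $G$ be a finite group and let $p$ be a prime dividing $|G|$. Let $E=\langle e_1,\dots,e_r\rangle$ be a maximal elementary abelian $p$-subgroup of $G$ of rank $r$, and for $1\le i\le r$ let $E_i=\langle e_1,\dots,\widehat{e_i},\dots,e_r\rangle$. Assume that there are elements $c_1,\dots,c_r\in G$ with $c_i\in C_G(E_i)\setminus N_G(\langle e_i\rangle)$ and $[c_i,c_j]=1$ for all $1\leq i,j\leq r$. Then $\widetilde H_{r-1}(|\mathcal A_p(G)|)\neq 0$, and hence Quillen's conjecture holds for $G$ at $p$. If furthermore $r=\operatorname{rk}_p(G)$, then $\mathcal Q\mathcal D_p$ holds for $G$.
   Context: $\mathcal A_p(G)$ is the poset of all non-trivial elementary abelian $p$-subgroups of $G$ ordered by inclusion; $|\mathcal A_p(G)|$ is its geometric realization (the simplicial complex whose simplices are the chains in $\mathcal A_p(G)$), and $\widetilde H_*$ denotes reduced integral simplicial homology. A maximal elementary abelian $p$-subgroup is a maximal element of $\mathcal A_p(G)$ (not necessarily of maximal rank). The rank of an elementary abelian $p$-group of order $p^r$ is $r$; the $e_i$ form a basis of $E$ over $\mathbb F_p$. $\operatorname{rk}_p(G)$ is the maximum of the ranks of the elementary abelian $p$-subgroups of $G$. The hat means that the generator is omitted. Quillen's conjecture holds for $G$ at $p$ means: if $|\mathcal A_p(G)|$ is contractible then $O_p(G)\ne 1$, where $O_p(G)$ is the largest normal $p$-subgroup of $G$. $\mathcal Q\mathcal D_p$ (the Quillen dimension at $p$ property) holds for $G$ means: $\widetilde H_{s-1}(|\mathcal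 A_p(G)|)\neq 0$ where $s=\operatorname{rk}_p(G)$. *)

(* Defs.v *)
From HB Require Import structures.
From mathcomp Require Import all_boot all_order all_algebra.
From mathcomp Require Import all_fingroup all_solvable.
From mathcomp Require Import classical_sets set_interval reals topology normedtype.
Import numFieldNormedType.Exports.

Set Implicit Arguments.
Unset Strict Implicit.
Unset Printing Implicit Defensive.

Import Order.TTheory GRing.Theory Num.Theory.

Local Open Scope classical_set_scope.
Local Open Scope ring_scope.

Section OrderComplex.
Context {d : Order.disp_t} (P : finPOrderType d).

(* The simplices of the order complex with k vertices, i.e. of dimension k - 1,
   listed in increasing order. Indexing by the number of vertices makes the
   empty simplex (k = 0) the generator of the augmentation term, so that the
   complex below computes reduced homology. *)
Record simplex (k : nat) : predArgType := Simplex {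
  vertices :> k.-tuple P;
  _ : sorted (fun x y => x < y)%O vertices
}.

HB.instance Definition _ k := [isSub for @vertices k].
HB.instance Definition _ k := [Finite of simplex k by <:].

Local Notation chains k := {ffun simplex k -> int}.

Definition is_face k (i : 'I_k.+1) (s : simplex k.+1) (t : simplex k) : bool :=
  t == take i s ++ drop i.+1 s :> seq P.

Definition boundary k (c : chains k.+1) : chains k :=
  [ffun t => \sum_(s : simplex k.+1) \sum_(i < k.+1 | is_face i s t)
               (-1) ^+ i * c s].

Definition is_cycle k : chains k -> Prop :=
  match k with
  | 0 => fun=> True
  | k'.+1 => fun c => boundary c = 0
  end.

Definition is_boundary k (c : chains k) : Prop :=
  exists b : chains k.+1, boundary b = c.

(* The reduced integral homology group in degree k - 1 is nonzero. The shift
   gives access to degree -1, which is nonzero exactly for the empty poset. *)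
Definition reduced_homology_pred_neq0 (k : nat) : Prop :=
  exists c : chains k, is_cycle c /\ ~ is_boundary c.

(* Barycentric coordinates. As P is finite, the topology of the realization is
   the one induced by the product topology of R^P. *)
Definition realization (R : realType) : set (prod_topology (fun _ : P => R)) :=
  [set f | [/\ forall x : P, 0 <= f x,
               \sum_(x : P) f x = 1
             & forall x y : P, f x != 0 -> f y != 0 -> (x >=< y)%O]].

End OrderComplex.

Arguments realization {d} P R _.
Arguments reduced_homology_pred_neq0 {d} P k.

Definition contractible (R : realType) (X : topologicalType) (A : set X) : Prop :=
  exists (x0 : X) (h : X * R -> X),
    [/\ A x0,
        {within (A `*` `[0%R, 1%R]%classic), continuous h},
        forall (x : X) (t : R), A x -> 0 <= t <= 1 -> A (h (x, t)),
        forall x, A x -> h (x, 0) = x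
      & forall x, A x -> h (x, 1) = x0].

Section QuillenComplex.
Local Open Scope group_scope.
Context {gT : finGroupType} (p : nat) (G : {group gT}).

Record Ap : predArgType := MkAp {
  Ap_group :> {group gT};
  _ : (Ap_group \in 'E_p(G)) && (Ap_group :!=: 1)
}.

HB.instance Definition _ := [isSub for Ap_group].
HB.instance Definition _ := [Finite of Ap by <:].

Definition Ap_le (E F : Ap) : bool := E \subset F.

Fact Ap_le_refl : reflexive Ap_le.
Proof. by move=> E; apply: subxx. Qed.

Fact Ap_le_anti : antisymmetric Ap_le.
Proof.
move=> E F /andP[EF FE]; do 2!apply: val_inj => /=; apply/eqP.
by rewrite finset.eqEsubset; apply/andP; split.
Qed.

Fact Ap_le_trans : transitive Ap_le.
Proof. move=> F E H; rewrite /Ap_le; exact: fintype.subset_trans. Qed.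

HB.instance Definition _ := Order.Le_isPOrder.Build
  (Order.Disp tt tt) Ap Ap_le_refl Ap_le_anti Ap_le_trans.

Definition quillen_conjecture_at (R : realType) : Prop :=
  contractible R (realization Ap R) -> 'O_p(G) != 1.

Definition quillen_dimension_at : Prop :=
  reduced_homology_pred_neq0 Ap 'r_p(G).

End QuillenComplex.

Arguments Ap {gT} p G.
Arguments quillen_conjecture_at {gT} p G R.
Arguments quillen_dimension_at {gT} p G.

(* Main.v *)
Require Import Defs.
From mathcomp Require Import boolp classical_sets set_interval.
From mathcomp Require Import reals topology normedtype.
From mathcomp Require Import all_boot all_order all_algebra.
From mathcomp Require Import all_fingroup all_solvable.
Import numFieldNormedType.Exports.

(** Write v_i^0 for e_i and v_i^1 for its conjugate by c_i.  The c_i commute and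
    c_j centralises e_i when j differs from i, so conjugation by the product of
    the c_i with i in S moves exactly the e_i with i in S, and moves them to
    v_i^1.  Hence any choice of one v_i per index generates a conjugate of E,
    and sending a face of the cross-polytope on the 2r points v_i^0, v_i^1 to
    the subgroup generated by its vertices is an order preserving map into
    A_p(G) ([Ap_face_octahedron]).  In this way the barycentric subdivision of
    an (r-1)-sphere is mapped to A_p(G).

    Call the facet with vertices e_1, .., e_r positive and consider the flag
    <e_1> < <e_1, e_2> < .. < E.  It is a maximal chain, since E is maximal and
    the ranks leave no gap.  It is also the image of a single simplex of the
    sphere, because no v_i^1 lies in E ([conj_notin]): otherwise v_i^1 would
    commute with c_k for all k distinct from i, but the centraliser of c_k in E
    is E_k, and the intersection of these E_k is <e_i>, which c_i does not
    normalise.  So the image of the fundamental cycle has coefficient 1 at a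
    simplex that is a face of no larger one; it is not a boundary
    ([octahedron_homology]).

    For the conjecture it remains to see that |A_p(G)| is not contractible.
    This follows from the same configuration by a parity count in the style of
    Sperner, so that simplicial approximation and the homology of spaces are
    avoided.  A contraction h extends the map of the sphere to the ball.  The
    ball is made of the cubes {0..2N}^r, one per orthant, glued along the
    coordinate hyperplanes, each cut into unit cubes and those into simplices by
    Kuhn's triangulation.  Label every grid point by an element of A_p(G) that
    has a large barycentric coordinate at its image.  For N large, uniform
    continuity makes the labels of neighbouring points comparable, and then a
    simplex has an even number of facets labelled by the whole flag, since the
    flag is a maximal chain.  Facets in the interior are counted twice, so the
    number of such facets on the boundary sphere is even ([kuhn_stokes]); but
    there the labels are known, and exactly one facet carries the flag
    ([octahedral_sperner], [octahedron_not_contractible]). *)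

Set Implicit Arguments.
Unset Strict Implicit.
Unset Printing Implicit Defensive.

Import Order.TTheory GRing.Theory Num.Theory.

(** * Uniform continuity on the realization *)

Section UniformContinuity.
Local Open Scope ring_scope.
Local Open Scope classical_set_scope.
Variables (R : realType).

(** With finitely many factors, the boxes of positive radius form a basis of
    neighbourhoods in the topology of pointwise convergence. *)
Lemma nbhs_ptws_box (I : finType) (f : prod_topology (fun _ : I => R)) U :
  nbhs f U ->
  exists2 d : R, 0 < d & forall g, (forall i, `|f i - g i| < d) -> U g.
Proof.
pose box (d : R) : set (prod_topology (fun _ : I => R)) :=
  [set g | forall i, `|f i - g i| < d].
pose F := filter_from [set d : R | 0 < d] box.
have FF : Filter F.
  apply: filter_from_filter; first by exists 1 => /=.
  move=> d1 d2 /= d1_gt0 d2_gt0; exists (Num.min d1 d2).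
    by rewrite /= lt_min d1_gt0.
  by move=> g gd; split=> i; have := gd i; rewrite lt_min => /andP[].
have Ff : F --> f.
  apply/cvg_sup => i V [B [[W oW] WB] Bf] /= BV.
  have Wf : W (f i) by have : B f by []; rewrite -WB.
  have /nbhs_ballP[d d_gt0 dW] : nbhs (f i) W by apply: open_nbhs_nbhs; split.
  by exists d => // g gd; apply: BV; rewrite -WB /=; apply: dW; exact: gd.
by move=> /Ff [d d_gt0 dU]; exists d.
Qed.

Lemma ptws_box_nbhs (I : finType) (f : prod_topology (fun _ : I => R)) (d : R) :
  0 < d -> nbhs f [set g | forall i, `|f i - g i| < d].
Proof.
move=> d_gt0.
pose B i : set (prod_topology (fun _ : I => R)) := [set g | `|f i - g i| < d].
have nj i : nbhs f (B i).
  have cf : (fun g : prod_topology (fun _ : I => R) => g i) @ f --> f i.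
    exact: (@proj_continuous I (fun=> R) i f).
  apply: (cf [set y | `|f i - y| < d]).
  exact: (nbhsx_ballx (f i) d d_gt0).
exact: (@filter_forall _ I B (nbhs f) (nbhs_filter f) nj).
Qed.

(** The Heine-Cantor theorem, with moduli of continuity measured coordinatewise
    because that is how the simplicial estimates below are obtained. *)
Lemma compact_unif_continuous (I J : finType)
    (K : set (prod_topology (fun _ : I => R) * R)%type)
    (h : prod_topology (fun _ : I => R) * R -> prod_topology (fun _ : J => R)) :
  compact K -> {within K, continuous h} -> forall e : R, 0 < e ->
  exists2 d : R, 0 < d & forall z z', K z -> K z' ->
    (forall i, `|z.1 i - z'.1 i| <= d) -> `|z.2 - z'.2| <= d ->
    forall j, `|h z j - h z' j| < e.
Proof.
move=> cK /subspace_continuousP ch e e_gt0.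
have /compact_near_coveringP/near_covering_withinP cov := cK.
pose P (d : R) z := forall z', K z' ->
    (forall i, `|z.1 i - z'.1 i| <= d) -> `|z.2 - z'.2| <= d ->
    forall j, `|h z j - h z' j| < e.
have : \forall d \near (0:R)^'+, K `<=` P d; last first.
  move=> nP.
  have /filter_ex[d [d_gt0 Kd]] :
      nbhs (0 : R)^'+ ([set d | 0 < d] `&` [set d | K `<=` P d]).
    by apply: filterI nP; exact: nbhs_right_gt.
  by exists d => // z z' Kz Kz'; apply: Kd.
apply: cov => z Kz.
have [B nB hB] : exists2 B, nbhs z B &
    forall w, B w -> K w -> forall j, `|h z j - h w j| < e / 2.
  pose C j : set (prod_topology (fun _ : I => R) * R)%type :=
    [set w | `|h z j - h w j| < e / 2].
  have nj j : within K (nbhs z) (C j).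
    have cj : (fun w => h w j) @ within K (nbhs z) --> h z j.
      apply: (@cvg_comp _ _ _ h (fun g => g j) _ (nbhs (h z))); first exact: ch.
      exact: (@proj_continuous J (fun=> R) j).
    apply: (cj [set y | `|h z j - y| < e / 2]).
    by apply: (nbhsx_ballx (h z j)); rewrite divr_gt0.
  exists [set w | K w -> forall j, C j w]; last by [].
  exact: (@filter_forall _ J C _ (within_filter K (nbhs_filter z)) nj).
have [/= [U V] [/= nU nV] UVB] := nB.
have [d1 d1_gt0 dU] := nbhs_ptws_box nU.
have /nbhs_ballP[d2 /= d2_gt0 dV] := nV.
(* Half the radius, so that a point close to a point close to z is in B. *)
pose d := Num.min d1 d2 / 2.
have d_gt0 : 0 < d by rewrite divr_gt0 // lt_min d1_gt0.
have ltd1 : d + d <= d1 by rewrite -splitr ge_min lexx.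
have ltd2 : d + d <= d2 by rewrite -splitr ge_min lexx orbT.
exists ([set w | (forall i, `|z.1 i - w.1 i| < d) /\ `|z.2 - w.2| < d],
        [set c | c < d]); first split.
- exists ([set w1 | forall i, `|z.1 i - w1 i| < d], [set w2 | `|z.2 - w2| < d]).
    by split=> /=; [exact: ptws_box_nbhs | exact: (nbhsx_ballx z.2)].
  by case=> w1 w2 [].
- exact: nbhs_right_lt.
move=> [w c] /= [[zw1 zw2] cd] Kw w' Kw' ww'1 ww'2 j.
have near1 : B w.
  apply: UVB; split.
    apply: dU => i; apply: lt_le_trans (zw1 i) (le_trans _ ltd1).
    by rewrite lerDl ltW.
  by apply: dV; apply: lt_le_trans zw2 (le_trans _ ltd2); rewrite lerDl ltW.
have near2 : B w'.
  apply: UVB; split.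
    apply: dU => i; apply: lt_le_trans ltd1.
    apply: le_lt_trans (ler_distD (w.1 i) _ _) _; apply: ltrD => //.
    exact: le_lt_trans (ww'1 i) cd.
  apply: dV; apply: lt_le_trans ltd2.
  apply: le_lt_trans (ler_distD w.2 _ _) _; apply: ltrD => //.
  exact: le_lt_trans ww'2 cd.
rewrite (splitr e); apply: le_lt_trans (ler_distD (h z j) _ _) _; apply: ltrD.
  by rewrite distrC; exact: hB.
exact: hB.
Qed.

(** The realization is closed in the cube: the condition that the support be a
    chain says that a product of two coordinates vanishes for each pair of
    incomparable elements. *)
Lemma compact_realization d (P : finPOrderType d) : compact (realization P R).
Proof.
pose T := prod_topology (fun _ : P => R).
have coord_cont (x : P) : continuous (fun f : T => f x).
  exact: (@proj_continuous P (fun=> R) x).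
have cube_compact : compact [set f : T | forall x, `[0, 1] (f x)].
  exact: (@tychonoff P (fun=> R) (fun=> `[0%R, 1%R])
                     (fun=> @segment_compact R 0 1)).
apply: subclosed_compact cube_compact _; last first.
  move=> f [f_ge0 f_sum _] x /=.
  rewrite in_itv /= f_ge0 -f_sum (bigD1 x) //= lerDl.
  by apply: sumr_ge0.
have -> : realization P R =
   (\bigcap_x (fun f : T => f x) @^-1` [set y | 0 <= y]) `&`
   (fun f : T => \sum_(x : P) f x) @^-1` [set 1] `&`
   \bigcap_(xy in [set xy : P * P | ~~ (xy.1 >=< xy.2)%O])
      (fun f : T => f xy.1 * f xy.2) @^-1` [set 0].
  apply/seteqP; split=> f /=.
    case=> f_ge0 f_sum f_ch; split; first by split=> // x _; exact: f_ge0.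
    move=> [x y] /= xy; apply/eqP; rewrite mulf_eq0; apply: contraNT xy.
    by rewrite negb_or => /andP[]; apply: f_ch.
  case=> [[f_ge0 f_sum] f_ch]; split=> // [x|x y fx fy]; first exact: f_ge0.
  apply: contraPT isT => xy; have := f_ch (x, y) xy => /= /eqP.
  by rewrite mulf_eq0 (negPf fx) (negPf fy).
apply: closedI; first apply: closedI.
- apply: closed_bigI => x _; apply: (preimage_closed _ (@closed_ge R 0)).
  by move=> f _; exact: coord_cont.
- apply: preimage_closed (@closed_eq R 1).
  move=> f _; apply: continuous_big => [|x _]; last exact: coord_cont.
  exact: add_continuous.
- apply: closed_bigI => -[x y] _; apply: preimage_closed (@closed_eq R 0).
  by move=> f _; apply: continuousM; exact: coord_cont.
Qed.

End UniformContinuity.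

(** * A Stokes formula modulo 2 for triangulated cubes *)

(** Each pair of the involution contributes its term twice. *)
Lemma addb_involution (X : finType) (A : pred X) (F : X -> bool) (t : X -> X) :
  involutive t -> (forall x, A (t x) = A x) ->
  (forall x, A x -> t x != x) -> (forall x, A x -> F (t x) = F x) ->
  \big[addb/false]_(x | A x) F x = false.
Proof.
move=> tK At tN Ft; pose low x := enum_rank x < enum_rank (t x).
rewrite (bigID low) /= [X in _ (+) X](reindex_inj (inv_inj tK)) /=.
rewrite [X in _ (+) X](_ : _ = \big[addb/false]_(x | A x && low x) F x).
  by rewrite addbb.
apply: eq_big => [x|x /andP[Ax _]]; last by rewrite Ft // -At.
rewrite At; case Ax: (A x) => //=; rewrite /low tK -leqNgt leq_eqVlt.
rewrite (inj_eq val_inj) (inj_eq enum_rank_inj) eq_sym.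
by rewrite (negPf (tN x Ax)).
Qed.

(** Exchanging the positions k and k+1 alters the initial segments of an
    ordering in just one length. *)
Lemma ltn_tperm_adjacent n (k : 'I_n) (i : 'I_n.+1) j : j != k.+1 ->
  (tperm (widen_ord (leqnSn n) k) (lift ord0 k) i < j) = (i < j).
Proof.
move=> jk; case: tpermP => [->|->|//] /=; rewrite /bump /= add1n.
  by rewrite ltn_neqAle eq_sym jk.
by rewrite [RHS]ltn_neqAle eq_sym jk.
Qed.

Section KuhnStokes.

Variables n M : nat.
Local Notation I := 'I_n.+1.
Local Notation signs := {ffun I -> bool}.
Local Notation point := {ffun I -> nat}.
Local Notation cell := (signs * {ffun I -> 'I_M.+1} * 'S_n.+1)%type.

Definition flip (i : I) (eps : signs) : signs :=
  [ffun j => eps j (+) (j == i)].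

Lemma flipK i : involutive (flip i).
Proof. by move=> eps; apply/ffunP=> j; rewrite !ffunE -addbA addbb addbF. Qed.

Lemma flip_neq i eps : flip i eps != eps.
Proof.
by apply/eqP=> /ffunP/(_ i); rewrite ffunE eqxx addbT; case: (eps i).
Qed.

(** The vertices of the simplex of the unit cube at v that is attached to s: the
    path from v to the opposite corner that increases coordinate i at step
    s i + 1. *)
Definition kuhn_vertex (v : {ffun I -> 'I_M.+1}) (s : 'S_n.+1) (k : nat) :
    point :=
  [ffun i => v i + (s i < k)].

Variables (T : Type) (L : signs -> point -> T).

Definition kuhn_facet (x : cell) (k : nat) : seq T :=
  [seq L x.1.1 (kuhn_vertex x.1.2 x.2 j) | j <- iota 0 n.+2 & j != k].

Lemma eq_kuhn_facet (x y : cell) k :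
  (forall j, j < n.+2 -> j != k ->
     L x.1.1 (kuhn_vertex x.1.2 x.2 j) = L y.1.1 (kuhn_vertex y.1.2 y.2 j)) ->
  kuhn_facet x k = kuhn_facet y k.
Proof.
move=> eqxy; apply/eq_in_map => j; rewrite mem_filter mem_iota.
by move=> /andP[jk /andP[_ jn]]; exact: eqxy.
Qed.

Lemma kuhn_facet0 (x : cell) : kuhn_facet x 0 =
  [seq L x.1.1 (kuhn_vertex x.1.2 x.2 j.+1) | j <- iota 0 n.+1].
Proof.
rewrite /kuhn_facet -[iota 0 n.+2]/(0 :: iota (1 + 0) n.+1) iotaDl /= filter_map.
by rewrite (@eq_filter _ _ predT) // filter_predT -map_comp.
Qed.

Lemma kuhn_facet_last (x : cell) : kuhn_facet x n.+1 =
  [seq L x.1.1 (kuhn_vertex x.1.2 x.2 j) | j <- iota 0 n.+1].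
Proof.
rewrite /kuhn_facet -[n.+2]addn1 iotaD filter_cat /= add0n eqxx /= cats0.
rewrite (@eq_in_filter _ _ predT) ?filter_predT // => j.
by rewrite mem_iota => /andP[_]; rewrite ltn_neqAle => /andP[].
Qed.

Variable full : pred (seq T).
Hypothesis glue :
  forall eps (y : point) i, y i = 0 -> L (flip i eps) y = L eps y.

Let swap (k : 'I_n) (x : cell) : cell :=
  (x.1.1, x.1.2, (x.2 * tperm (widen_ord (leqnSn n) k) (lift ord0 k))%g).

(** A facet that omits an inner vertex of the path lies inside its unit cube and
    is shared by the two simplices that differ by an exchange of two steps. *)
Lemma kuhn_facet_middle (k : 'I_n) :
  \big[addb/false]_(x : cell) full (kuhn_facet x k.+1) = false.
Proof.
have neq : widen_ord (leqnSn n) k != lift ord0 k.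
  by rewrite -val_eqE /= /bump /= add1n neq_ltn ltnSn.
apply: (@addb_involution _ xpredT _ (swap k)) => //.
- by move=> [[eps v] s]; rewrite /swap /= -mulgA tperm2 mulg1.
- move=> [[eps v] s] _; apply/eqP => -[] /(canRL (mulKg s)).
  rewrite mulVg => /permP/(_ (lift ord0 k)); rewrite tpermR perm1 => /eqP.
  by rewrite (negPf neq).
move=> [[eps v] s] _; congr full; apply: eq_kuhn_facet => j _ jk /=.
congr L; apply/ffunP=> i; rewrite !ffunE permM; congr (_ + nat_of_bool _).
exact: ltn_tperm_adjacent.
Qed.

Let cyc : 'S_n.+1 := perm (@ord_pred_inj n.+1).

(** The simplex on the other side of the facet that omits the first vertex: it
    sits in the next unit cube in the direction of the first step, and takes
    this step last.  Wrapping around at the end of the grid makes shift a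
    bijection of all simplices. *)
Let shift (x : cell) : cell :=
  (x.1.1, [ffun i => if x.2 i == ord0 then ordS (x.1.2 i) else x.1.2 i],
   (x.2 * cyc)%g).

Lemma shift_inj : injective shift.
Proof.
move=> [[eps v] s] [[eps' v'] s'] [<- vv' /mulIg ss']; rewrite -{}ss' in vv' *.
congr (_, _, _); apply/ffunP=> i; move/ffunP/(_ i): vv'; rewrite !ffunE.
by case: ifP => // _ /ordS_inj.
Qed.

Lemma cyc0 : cyc ord0 = ord_max.
Proof. by apply: val_inj; rewrite permE /= modn_small. Qed.

Lemma cycS (i : I) : i != ord0 -> (cyc i).+1 = i.
Proof.
rewrite -val_eqE /= -lt0n => i_gt0.
rewrite permE /= -{1}(prednK i_gt0) addSn /= modnDr modn_small.
  exact: prednK.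
exact: leq_ltn_trans (leq_pred i) _.
Qed.

Lemma kuhn_facet_shift (x : cell) :
  x.1.2 (x.2^-1%g ord0) != ord_max ->
  kuhn_facet (shift x) n.+1 = kuhn_facet x 0.
Proof.
case: x => [[eps v] s] /= v_max; rewrite kuhn_facet0 kuhn_facet_last.
apply/eq_in_map => j; rewrite mem_iota => /andP[_ jn] /=; congr L.
apply/ffunP=> i; rewrite !ffunE permM; case: eqVneq => [si0|si0].
  have vi : v i != ord_max by rewrite -(permK s i) si0.
  rewrite si0 cyc0 /= [n < j]ltnNge -ltnS jn addn0 addn1 modn_small //.
  by rewrite ltnS ltn_neqAle -ltnS ltn_ord andbT.
by rewrite -[in LHS]ltnS cycS.
Qed.

Lemma shift_boundary (x : cell) :
  ((shift x).1.2 ((shift x).2^-1%g ord_max) != ord0)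
    = (x.1.2 (x.2^-1%g ord0) != ord_max).
Proof.
case: x => [[eps v] s] /=.
have -> : (s * cyc)^-1%g ord_max = s^-1%g ord0.
  by apply: (canLR (permK _)); rewrite permM permKV cyc0.
rewrite ffunE permKV eqxx -!val_eqE /=; congr (~~ _).
case: (ltngtP (v (s^-1%g ord0)) M) => [lt|gt|->]; last by rewrite modnn eqxx.
  by rewrite modn_small.
by have := ltn_ord (v (s^-1%g ord0)); rewrite ltnS leqNgt gt.
Qed.

(** Summed over all simplices of all orthants, facets inside the ball cancel in
    pairs: within a unit cube, between adjacent unit cubes, or between two
    orthants along a coordinate hyperplane.  What is left are the facets where
    the first step of the path reaches the far end of the grid. *)
Lemma kuhn_stokes :
  \big[addb/false]_(x : cell) \big[addb/false]_(k < n.+2) full (kuhn_facet x k)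
  = \big[addb/false]_(x : cell | x.1.2 (x.2^-1%g ord0) == ord_max)
       full (kuhn_facet x 0).
Proof.
rewrite exchange_big big_ord_recl big_ord_recr /= /bump /= add1n.
rewrite [X in _ (+) (X (+) _)]big1 => [|k _]; last exact: kuhn_facet_middle.
rewrite addFb.
rewrite (bigID (fun x : cell => x.1.2 (x.2^-1%g ord0) == ord_max)) /=.
rewrite -addbA; set inner := (X in _ (+) X).
suff -> : inner = false by rewrite addbF.
rewrite {}/inner [X in _ (+) X](bigID
  (fun x : cell => x.1.2 (x.2^-1%g ord_max) == ord0)) /=.
rewrite [X in _ (+) (X (+) _)](addb_involution (t :=
  fun x : cell => (flip (x.2^-1%g ord_max) x.1.1, x.1.2, x.2))); first last.
- move=> [[eps v] s] /= /eqP v0; congr full; rewrite !kuhn_facet_last.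
  apply/eq_in_map => j; rewrite mem_iota => /andP[_ jn] /=; apply: glue.
  by rewrite ffunE v0 permKV /= ltnNge -ltnS jn.
- by move=> [[eps v] s] /= _; rewrite !xpair_eqE !eqxx !andbT; exact: flip_neq.
- by [].
- by move=> [[eps v] s] /=; rewrite flipK.
rewrite addFb [X in _ (+) X](reindex_inj shift_inj) /=.
set S1 := (X in X (+) _); rewrite [X in _ (+) X](_ : _ = S1) ?addbb //.
apply: eq_big => x; first exact: shift_boundary.
by move=> x0; rewrite kuhn_facet_shift // -shift_boundary.
Qed.

End KuhnStokes.

(** * Octahedral spheres in a poset *)

Lemma addb_count_mem (X : Type) (T : eqType) (f : X -> T) (b : T) (s : seq X) :
  \big[addb/false]_(j <- s) (f j == b) = odd (count_mem b (map f s)).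
Proof.
by elim: s => [|j s IHs]; rewrite ?big_nil // big_cons IHs /= oddD oddb.
Qed.

(** The facet omitting k is full if and only if the list of all labels is f k
    together with sigma.  If this happens for some k, then b = f k is in sigma by
    assumption; so b occurs twice, and the full facets are the two that omit an
    occurrence of b. *)
Lemma even_full_facets (T : eqType) (f : nat -> T) (m : nat) (sigma : seq T) :
  uniq sigma ->
  (forall k, k < m ->
     perm_eq [seq f j | j <- iota 0 m & j != k :> nat] sigma -> f k \in sigma) ->
  \big[addb/false]_(k < m)
     perm_eq [seq f j | j <- iota 0 m & j != k :> nat] sigma = false.
Proof.
move=> sigma_uniq closed; set S := [seq f j | j <- iota 0 m].
have facetE k : k < m ->
    perm_eq [seq f j | j <- iota 0 m & j != k :> nat] sigma
    = perm_eq S (f k :: sigma).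
  move=> km; rewrite -(perm_cons (f k)); apply: permPl.
  rewrite -(map_cons f); apply: perm_map; rewrite perm_sym.
  have k_in : k \in iota 0 m by rewrite mem_iota.
  by rewrite -(rem_filter k (iota_uniq 0 m)) perm_to_rem.
have [k0 full0|none] := pickP (fun k : 'I_m => perm_eq S (f k :: sigma));
  last by rewrite big1 // => k _; rewrite facetE // none.
set b := f k0 in full0.
have b_in : b \in sigma by apply: closed; rewrite ?facetE.
have eq_b (k : 'I_m) :
    perm_eq [seq f j | j <- iota 0 m & j != k :> nat] sigma = (f k == b).
  rewrite facetE // (permPl full0) -cat1s -[f k :: _]cat1s perm_cat2r.
  by apply/idP/eqP => [/perm_small_eq-/(_ isT)[]|->//].
rewrite (eq_bigr _ (fun k _ => eq_b k)).
rewrite -(big_mkord xpredT (fun k => f k == b)) addb_count_mem /index_iota subn0.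
by rewrite (seq.permP full0) /= eqxx count_uniq_mem // b_in.
Qed.

Section Octahedron.
Local Open Scope order_scope.

Variables (n : nat) (d : Order.disp_t) (P : finPOrderType d).
Local Notation I := 'I_n.+1.
Local Notation signs := {ffun I -> bool}.
Local Notation point := {ffun I -> nat}.

Definition positive : signs := [ffun=> false].
Definition initial (k : nat) : {set I} := [set i : I | (i < k)%N].

(** The cross-polytope has vertices i+ and i- for i in I.  A pair (eps, A) with
    A nonempty stands for its face with one vertex over each i in A, of the sign
    eps i, and phi sends the barycentre of this face to P; [octa_local] says that
    the value depends on the face alone.  The last three conditions isolate the
    flag of faces {0} < {0, 1} < .. < I of the positive facet: no other flag of
    faces has the same image, and this image is a maximal chain of P. *)
Record octahedron (phi : signs -> {set I} -> P) : Prop := Octahedron {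
  octa_lt : forall eps (A B : {set I}),
    A != set0 -> A \proper B -> phi eps A < phi eps B;
  octa_local : forall (eps eps' : signs) (A : {set I}),
    {in A, eps =1 eps'} -> phi eps A = phi eps' A;
  octa_top : forall eps, phi eps setT = phi positive setT -> eps = positive;
  octa_inj : {in predC1 set0 &, injective (phi positive)};
  octa_max : forall x,
    (forall k, (0 < k <= n.+1)%N -> x >=< phi positive (initial k)) ->
    exists2 k, (0 < k <= n.+1)%N & x = phi positive (initial k)
}.

Variable phi : signs -> {set I} -> P.
Hypothesis octa_phi : octahedron phi.

Definition flag : seq P := [seq phi positive (initial k) | k <- iota 1 n.+1].

Lemma octa_le eps (A B : {set I}) :
  A != set0 -> A \subset B -> phi eps A <= phi eps B.
Proof.
rewrite subEproper => A0 /predU1P[->//|AB].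
by apply: ltW; exact: (octa_lt octa_phi).
Qed.

Lemma initial_neq0 k : (0 < k)%N -> initial k != set0.
Proof. by move=> k0; apply/set0Pn; exists ord0; rewrite inE. Qed.

Lemma card_initial k : (k <= n.+1)%N -> #|initial k| = k.
Proof.
move=> kn; rewrite -[RHS]card_ord -!sum1_card (big_ord_widen n.+1 (fun=> 1%N) kn).
by apply: eq_bigl => i; rewrite inE.
Qed.

Lemma initial_inj k l : (k <= n.+1)%N -> (l <= n.+1)%N ->
  initial k = initial l -> k = l.
Proof.
by move=> kn ln /(congr1 (fun A : {set I} => #|A|)); rewrite !card_initial.
Qed.

Lemma flag_uniq : uniq flag.
Proof.
rewrite map_inj_in_uniq ?iota_uniq // => k l.
rewrite !mem_iota add1n !ltnS => /andP[k0 kn] /andP[l0 ln].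
by move/(octa_inj octa_phi) => kl; apply: initial_inj => //; apply: kl;
   rewrite inE initial_neq0.
Qed.

(** Both lists are sorted, so they agree entry by entry.  As the flag has no
    repetition, the sets J k increase strictly and J (n+1) is all of I; then
    [octa_top] determines the signs and [octa_inj] the sets. *)
Lemma flag_unique eps (J : nat -> {set I}) :
  (forall k, (0 < k)%N -> J k != set0) ->
  (forall k l, (k <= l)%N -> J k \subset J l) ->
  perm_eq [seq phi eps (J k) | k <- iota 1 n.+1] flag ->
  eps = positive /\ forall k, (0 < k <= n.+1)%N -> J k = initial k.
Proof.
move=> J0 Jmono full.
have sorted_seq eps' (J' : nat -> {set I}) :
    (forall k, (0 < k)%N -> J' k != set0) ->
    (forall k l, (k <= l)%N -> J' k \subset J' l) ->
    sorted <=%O [seq phi eps' (J' k) | k <- iota 1 n.+1].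
  move=> J'0 J'mono; apply/(sortedP (phi eps' set0)) => k.
  rewrite size_map size_iota => kn; have kn' := ltnW kn.
  rewrite !(nth_map 0) ?size_iota // !nth_iota // !add1n.
  by apply: octa_le; [exact: J'0 | exact: J'mono].
have eq_flag : [seq phi eps (J k) | k <- iota 1 n.+1] = flag.
  apply: le_sorted_eq full; apply: sorted_seq => //; first exact: initial_neq0.
  by move=> k l kl; apply/subsetP=> i; rewrite !inE => /leq_trans; apply.
have eq_k k : (0 < k <= n.+1)%N -> phi eps (J k) = phi positive (initial k).
  case: k => // k /= kn.
  have := congr1 (fun s => nth (phi eps set0) s k) eq_flag.
  by rewrite !(nth_map 0) ?size_iota // !nth_iota.
have J_card k : (k <= n.+1)%N -> (k <= #|J k|)%N.
  elim: k => // k IHk kn; have {}IHk := IHk (ltnW kn).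
  case: k => [|k] in IHk kn *; first by rewrite card_gt0 J0.
  apply: leq_ltn_trans IHk _; apply: proper_card.
  rewrite properEneq Jmono ?leqnSn // andbT; apply: contraTneq isT => eqJ.
  suff /initial_inj : initial k.+1 = initial k.+2.
    by move=> /(_ (ltnW kn) kn) /eqP; rewrite eqn_leq ltnn andbF.
  apply: (octa_inj octa_phi); rewrite ?inE ?initial_neq0 //.
  by rewrite -!eq_k ?eqJ // (ltnW kn).
have JT : J n.+1 = setT.
  by apply/eqP; rewrite eqEcard subsetT cardsT card_ord J_card.
have initT : initial n.+1 = setT by apply/setP=> i; rewrite !inE ltn_ord.
have eps0 : eps = positive.
  by apply: (octa_top octa_phi); rewrite -{1}JT -initT eq_k //= leqnn.
split=> // k /andP[k0 kn].
apply: (octa_inj octa_phi); rewrite ?inE ?J0 ?initial_neq0 //.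
by rewrite -eq_k ?k0 // eps0.
Qed.

Lemma flagP x :
  reflect (exists2 k, (0 < k <= n.+1)%N & x = phi positive (initial k))
          (x \in flag).
Proof.
apply: (iffP mapP) => -[k].
  by rewrite mem_iota add1n ltnS => kn xk; exists k.
by move=> kn xk; exists k; rewrite ?mem_iota ?add1n ?ltnS.
Qed.

End Octahedron.

(** * The homology class of an octahedral sphere *)

Section Homology.
Local Open Scope ring_scope.
Variables (n : nat) (d : Order.disp_t) (P : finPOrderType d).
Local Notation I := 'I_n.+1.
Local Notation signs := {ffun I -> bool}.
Variable phi : signs -> {set I} -> P.
Hypothesis octa_phi : octahedron phi.

Lemma sum_antisym (X : finType) (F : X -> int) (t : X -> X) :
  injective t -> (forall x, F (t x) = - F x) -> \sum_x F x = 0.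
Proof.
move=> t_inj Ft; have : \sum_x F x = - \sum_x F x.
  by rewrite [LHS](reindex_inj t_inj) -sumrN; apply: eq_bigr => x _.
by move/eqP; rewrite -addr_eq0 -mulr2n mulrn_eq0 /= => /eqP.
Qed.

Definition segment (s : 'S_n.+1) (k : nat) : {set I} := [set i : I | (s i < k)%N].

Lemma segment_neq0 s k : (0 < k)%N -> segment s k != set0.
Proof. by move=> k0; apply/set0Pn; exists (s^-1%g ord0); rewrite inE permKV. Qed.

Lemma segment_mono s k l : (k <= l)%N -> segment s k \subset segment s l.
Proof. by move=> kl; apply/subsetP=> i; rewrite !inE => /leq_trans; apply. Qed.

(** The simplices of the barycentric subdivision of the cross-polytope are the
    flags of faces: a facet eps and an ordering of its vertices, where s i is
    the position of vertex i. *)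
Definition octa_chain (x : signs * 'S_n.+1) : seq P :=
  [seq phi x.1 (segment x.2 k) | k <- iota 1 n.+1].

Fact octa_chain_size x : size (octa_chain x) == n.+1.
Proof. by rewrite size_map size_iota. Qed.

Fact octa_chain_sorted x : sorted (fun a b => a < b)%O (octa_chain x).
Proof.
apply/(sortedP (phi x.1 set0)) => k; rewrite size_map size_iota => kn.
have kn' := ltnW kn.
rewrite !(nth_map 0) ?size_iota // !nth_iota // !add1n.
apply: (octa_lt octa_phi); first exact: segment_neq0.
apply/properP; split; first exact: segment_mono.
by exists (x.2^-1%g (Ordinal kn)); rewrite inE permKV /= ?ltnSn ?ltnn.
Qed.

Definition octa_simplex x : simplex P n.+1 :=
  @Simplex _ P _ (Tuple (octa_chain_size x)) (octa_chain_sorted x).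

Definition signature (x : signs * 'S_n.+1) : int :=
  (-1) ^+ x.2 * \prod_i (-1) ^+ x.1 i.

Definition octa_cycle : {ffun simplex P n.+1 -> int} :=
  [ffun t => \sum_x signature x * (octa_simplex x == t)%:R].

Lemma face_map (f : nat -> P) i : (i < n.+1)%N ->
  take i (map f (iota 1 n.+1)) ++ drop i.+1 (map f (iota 1 n.+1))
  = [seq f k | k <- iota 1 n.+1 & k != i.+1].
Proof.
move=> i_n; have -> : iota 1 n.+1 = iota 1 i ++ i.+1 :: iota i.+2 (n - i).
  by rewrite -[in LHS](subnKC i_n) addSnnS iotaD subSS.
rewrite map_cat map_cons take_size_cat ?size_map ?size_iota //.
rewrite -cat1s catA drop_size_cat;
  last by rewrite size_cat size_map size_iota addn1.
rewrite filter_cat /= eqxx /= -map_cat; congr (map f (_ ++ _));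
  apply/esym/all_filterP/allP => k; rewrite mem_iota => /andP[k1 k2].
  by rewrite neq_ltn -[i.+1]add1n k2.
by rewrite neq_ltn k1 orbT.
Qed.

(** This is the fundamental cycle of the sphere.  Omitting a face below the top
    one from a flag leaves a chain that also arises after exchanging two
    consecutive vertices; omitting the facet leaves one that also arises from the
    facet in which the last vertex is replaced by its opposite.  Both changes
    reverse the sign. *)
Lemma octa_cycle_cycle : boundary octa_cycle = 0.
Proof.
apply/ffunP=> t; rewrite !ffunE.
transitivity (\sum_(i < n.+1) (-1) ^+ i *
   \sum_x signature x * (is_face i (octa_simplex x) t)%:R : int).
  under eq_bigr do rewrite big_mkcond /=.
  rewrite exchange_big /=; apply: eq_bigr => i _.
  transitivity (\sum_(s : simplex P n.+1) \sum_x
      (-1) ^+ i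
      * (signature x * ((octa_simplex x == s) && is_face i s t)%:R) : int).
    apply: eq_bigr => s _; case: ifP => _.
      by rewrite ffunE mulr_sumr; apply: eq_bigr => x _; rewrite andbT.
    by rewrite big1 // => x _; rewrite andbF !mulr0.
  rewrite exchange_big mulr_sumr; apply: eq_bigr => x _ /=.
  rewrite (bigD1 (octa_simplex x)) //= eqxx /= big1 ?addr0 // => s.
  by rewrite eq_sym => /negPf->; rewrite !mulr0.
apply: big1 => i _.
suff -> : \sum_x signature x * (is_face i (octa_simplex x) t)%:R = 0 :> int.
  by rewrite mulr0.
have [i_n|n_i] := ltnP i n.
  pose j := Ordinal i_n.
  apply: (@sum_antisym _ _ (fun x =>
    (x.1, x.2 * tperm (widen_ord (leqnSn n) j) (lift ord0 j))%g)).
    by move=> [e s] [e' s'] [-> /mulIg->].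
  move=> [e s]; rewrite -mulNr; congr (_ * _%:R).
    rewrite /signature /= odd_permM odd_tperm signr_addb.
    by rewrite -val_eqE /= /bump /= add1n neq_ltn ltnSn /= mulrN1 mulNr.
  rewrite /is_face /= /octa_chain !face_map //; congr (_ == _).
  apply/eq_in_map => k; rewrite mem_filter => /andP[ki _] /=; congr phi.
  by apply/setP=> a; rewrite !inE permM ltn_tperm_adjacent.
have i_max : i = ord_max.
  by apply: val_inj; apply/eqP; rewrite eqn_leq n_i -ltnS ltn_ord.
pose flip_last (x : signs * 'S_n.+1) : signs * 'S_n.+1 :=
  (flip (x.2^-1%g ord_max) x.1, x.2).
apply: (@sum_antisym _ _ flip_last).
  by move=> [e s] [e' s'] /= [+ ss']; rewrite ss' => /(inv_inj (flipK _))->.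
move=> [e s]; rewrite -mulNr; congr (_ * _%:R).
  rewrite /signature /= -mulrN; congr (_ * _).
  rewrite (bigD1 (s^-1%g ord_max)) //= [in RHS](bigD1 (s^-1%g ord_max)) //=.
  rewrite ffunE eqxx signr_addb mulrN1 mulNr; congr (- (_ * _)).
  by apply: eq_bigr => j /negPf j_neq; rewrite ffunE j_neq addbF.
rewrite /is_face /= /octa_chain !face_map //; congr (_ == _).
apply/eq_in_map => k.
rewrite mem_filter mem_iota i_max => /andP[ki /andP[_ kn]] /=.
apply: (octa_local octa_phi) => j; rewrite inE ffunE.
case: eqVneq => [->|_]; last by rewrite addbF.
by rewrite permKV /= ltnNge -ltnS ltn_neqAle ki -ltnS -[n.+2]add1n kn.
Qed.

Lemma octa_chain_flag_unique x :
  octa_chain x = flag phi -> x = (positive n, 1%g).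
Proof.
case: x => [eps s] eq_flag.
have [|||eps_pos seg_initial] := @flag_unique _ _ _ _ octa_phi eps (segment s).
- exact: segment_neq0.
- exact: segment_mono.
- by rewrite -[[seq _ | _ <- _]]/(octa_chain (eps, s)) eq_flag.
congr (_, _) => //; apply/permP=> i; rewrite perm1.
apply: val_inj; apply/eqP => /=.
rewrite eqn_leq; apply/andP; split.
  have /setP/(_ i) := seg_initial i.+1 (ltn_ord i).
  by rewrite !inE ltnSn ltnS => ->.
rewrite leqNgt; apply/negP => si.
have i_n : (0 < i <= n.+1)%N by rewrite (leq_ltn_trans _ si) //= ltnW.
by have /setP/(_ i) := seg_initial i i_n; rewrite !inE si ltnn.
Qed.

Lemma octa_chain_flag : octa_chain (positive n, 1%g) = flag phi.
Proof.
apply/eq_in_map => k _ /=; congr phi; apply/setP=> i.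
by rewrite !inE perm1.
Qed.

Let flag_simplex := octa_simplex (positive n, 1%g).

Lemma octa_cycle_flag : octa_cycle flag_simplex = 1.
Proof.
rewrite ffunE (bigD1 (positive n, 1%g)) //= big1 ?addr0 => [|x x_neq].
  rewrite eqxx mulr1 /signature odd_perm1 mul1r big1 // => i _.
  by rewrite /positive ffunE.
case: eqP => [/(congr1 (fun t : simplex P n.+1 => t : seq P)) /= | _];
  last by rewrite mulr0.
rewrite octa_chain_flag => /octa_chain_flag_unique/eqP.
by rewrite (negPf x_neq).
Qed.

(** The vertex of s outside the flag would be comparable with the whole flag, a
    maximal chain. *)
Lemma flag_not_face i (s : simplex P n.+2) : ~~ is_face i s flag_simplex.
Proof.
apply/negP; rewrite /is_face /= octa_chain_flag => /eqP flagE.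
have i_s : (i < size s)%N by rewrite size_tuple.
pose a := nth (phi (positive n) set0) s i.
have sE : s = take i s ++ a :: drop i.+1 s :> seq P.
  by rewrite -drop_nth // cat_take_drop.
have s_lt : sorted (fun x y => x < y)%O s by case: s {i_s a sE flagE}.
have s_uniq : uniq s by apply: sorted_uniq s_lt; [exact: lt_trans | exact: ltxx].
have s_comp : {in (s : seq P) &, forall x y, (x >=< y)%O}.
  have s_le : sorted <=%O s by apply: sub_sorted s_lt => x y; exact: ltW.
  move=> x y xs ys.
  have := sorted_leq_nth le_trans le_refl x s_le.
  move=> s_nth; rewrite -(nth_index x xs) -(nth_index x ys).
  have [xy|/ltnW yx] := leqP (index x (s : seq P)) (index y (s : seq P)).
    by rewrite le_comparable // s_nth // inE index_mem.
  by rewrite comparable_sym le_comparable // s_nth // inE index_mem.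
have a_s : a \in (s : seq P) by apply: mem_nth.
have flag_s x : x \in flag phi -> x \in (s : seq P).
  by rewrite flagE [in X in _ -> X]sE !mem_cat inE => /orP[]->; rewrite ?orbT.
have : a \in flag phi.
  have [|k kn ->] := octa_max octa_phi (x := a); last by apply/flagP; exists k.
  by move=> k kn; apply: s_comp => //; apply: flag_s; apply/flagP; exists k.
rewrite flagE; move: s_uniq.
rewrite [in X in X -> _]sE -cat1s uniq_catCA cat1s /=.
by case/andP => /negP.
Qed.

Lemma octahedron_homology : reduced_homology_pred_neq0 P n.+1.
Proof.
exists octa_cycle; split; first exact: octa_cycle_cycle.
case=> b /ffunP/(_ flag_simplex); rewrite octa_cycle_flag ffunE big1 // => s _.
by rewrite big_pred0 // => i; apply/negbTE/flag_not_face.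
Qed.

End Homology.

(** * Octahedral spheres obstruct contractibility *)

Section Sperner.
Local Open Scope order_scope.
Variables (n : nat) (d : Order.disp_t) (P : finPOrderType d).
Local Notation I := 'I_n.+1.
Local Notation signs := {ffun I -> bool}.
Local Notation point := {ffun I -> nat}.
Variable phi : signs -> {set I} -> P.
Hypothesis octa_phi : octahedron phi.
Local Notation positive := (positive n).
Local Notation initial := (initial n).
Local Notation flag := (flag phi).

Definition superlevel (c : nat) (y : point) : {set I} :=
  [set i : I | (c <= y i)%N].

Lemma kuhn_vertex_mono M (v : {ffun I -> 'I_M.+1}) s j k i : (j <= k)%N ->
  (kuhn_vertex v s j i <= kuhn_vertex v s k i <= (kuhn_vertex v s j i).+1)%N.
Proof.
move=> jk; rewrite !ffunE -addnS !leq_add2l.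
have [sj|_] := ltnP (s i) j; last by case: ltnP.
by rewrite (leq_trans sj jk).
Qed.

Lemma kuhn_vertex_bound M (v : {ffun I -> 'I_M.+1}) s j i :
  (kuhn_vertex v s j i <= M.+1)%N.
Proof.
rewrite ffunE; apply: leq_trans (leq_add (leqnn _) (leq_b1 _)) _.
by rewrite addn1 ltn_ord.
Qed.

(** On the far boundary of the orthant eps, the label of y is that of the face
    where y is at least c.  A facet there with all labels of the flag has the
    superlevel sets {0}, {0, 1}, .., I, which forces it to be the path from
    (M+1, c-1, .., c-1) that raises the coordinates 1, .., n in this order to c.
    So there is one such facet, while comparability of neighbouring labels would
    make their number even. *)
Lemma octahedral_sperner M c (L : signs -> point -> P) :
  (0 < c <= M.+1)%N ->
  (forall eps (y : point) i, y i = 0 -> L (flip i eps) y = L eps y) ->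
  (forall eps (y : point) i, y i = M.+1 -> L eps y = phi eps (superlevel c y)) ->
  (forall eps (y y' : point), (forall i, y i <= y' i <= (y i).+1)%N ->
     (forall i, y' i <= M.+1)%N -> L eps y >=< L eps y') ->
  False.
Proof.
move=> /andP[c0 cM] glue bound comp.
have := kuhn_stokes M (perm_eq^~ flag) glue.
rewrite big1 => [|[[eps v] s] _]; last first.
  apply: even_full_facets (flag_uniq octa_phi) _ => k kn fullk /=.
  suff /(octa_max octa_phi)[l ln ->] : forall l, (0 < l <= n.+1)%N ->
      L eps (kuhn_vertex v s k) >=< phi positive (initial l).
    by apply/flagP; exists l.
  move=> l ln.
  have : phi positive (initial l) \in flag by apply/flagP; exists l.
  rewrite -(perm_mem fullk) => /mapP[j _ ->] /=.
  have [jk|/ltnW kj] := leqP j k; first rewrite comparable_sym;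
    by apply: comp => i; [exact: kuhn_vertex_mono | exact: kuhn_vertex_bound].
have cM' : (c.-1 < M.+1)%N by rewrite prednK.
(* The simplex that has this path as the facet omitting its first vertex. *)
pose x0 : signs * {ffun I -> 'I_M.+1} * 'S_n.+1 :=
  (positive, [ffun i => if i == ord0 then ord_max else Ordinal cM'], 1%g).
have facetE (x : signs * {ffun I -> 'I_M.+1} * 'S_n.+1) :
    x.1.2 (x.2^-1%g ord0) == ord_max ->
    kuhn_facet L x 0 = [seq phi x.1.1 (superlevel c (kuhn_vertex x.1.2 x.2 k))
                       | k <- iota 1 n.+1].
  move=> /eqP x_max; rewrite kuhn_facet0 -[1%N]addn0 iotaDl -map_comp.
  apply/eq_in_map => j _ /=; apply: (bound _ _ (x.2^-1%g ord0)).
  by rewrite ffunE x_max permKV addn1.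
rewrite (bigD1 x0) /=; last by rewrite invg1 perm1 ffunE eqxx.
rewrite big1 ?addbF => [|x /andP[x_max x_neq]]; last first.
  apply/negP=> full_x; case/eqP: x_neq; move: full_x; rewrite facetE //.
  case: x x_max => [[eps v] s] /= /eqP v_max full_x.
  have [||eps0 Jk] := flag_unique octa_phi _ _ full_x.
  - move=> k k0; apply/set0Pn; exists (s^-1%g ord0).
    by rewrite inE ffunE v_max permKV k0 addn1.
  - move=> k l kl; apply/subsetP=> i; rewrite !inE => /leq_trans; apply.
    by have /andP[] := kuhn_vertex_mono v s i kl.
  have {}Jk k i : (0 < k <= n.+1)%N -> (c <= v i + (s i < k))%N = (i < k)%N.
    by move=> /Jk/setP/(_ i); rewrite !inE ffunE.
  have vs i : i != ord0 -> v i = Ordinal cM' /\ s i = i.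
    move=> i0; have {}i0 : (0 < i)%N by rewrite lt0n.
    have := Jk i i; rewrite i0 ltnW // ltnn => /(_ isT).
    have := Jk i.+1 i; rewrite ltn_ord ltnSn => /(_ isT).
    case: (ltngtP (s i) i) => [si|si|/val_inj si].
    - by rewrite ltnS (ltnW si) => ->.
    - by rewrite ltnNge si => ->.
    rewrite si ltnSn addn0 addn1 => cv vc; split=> //; apply: val_inj => /=.
    by apply/eqP; rewrite eqn_leq -ltnS prednK // ltnNge vc -ltnS prednK.
  have s00 : s^-1%g ord0 = ord0.
    apply/eqP; apply: contraT => /[dup] /vs[_].
    by rewrite permKV => <-; rewrite eqxx.
  rewrite /x0 -eps0; congr (_, _, _).
    apply/ffunP=> i; rewrite ffunE.
    by case: eqVneq => [->|/vs[]//]; rewrite -{1}s00.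
  apply/permP=> i; rewrite perm1; case: (eqVneq i ord0) => [->|/vs[]//].
  by rewrite -{1}s00 permKV.
suff -> : kuhn_facet L x0 0 = flag by rewrite perm_refl.
rewrite facetE; last by rewrite /= invg1 perm1 ffunE eqxx.
rewrite /flag; apply/eq_in_map => k; rewrite mem_iota => /andP[k0 _].
congr phi; apply/setP=> i.
rewrite !inE !ffunE perm1.
case: eqVneq => [->|_] /=; first by rewrite k0 addn1 cM.
case: (i < k)%N; rewrite /= ?addn1 ?addn0; rewrite ?prednK ?leqnn //.
by rewrite leqNgt prednK ?leqnn.
Qed.

End Sperner.

Section SpherePoint.
Local Open Scope ring_scope.
Variables (R : realType) (n : nat) (d : Order.disp_t) (P : finPOrderType d).
Local Notation I := 'I_n.+1.
Local Notation signs := {ffun I -> bool}.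
Local Notation point := {ffun I -> nat}.
Variable phi : signs -> {set I} -> P.
Hypothesis octa_phi : octahedron phi.
Variable N : nat.
Hypothesis N_gt0 : (0 < N)%N.

(** A grid point y of the orthant eps with a coordinate at least N represents,
    after truncation of its coordinates at N, a point of the boundary of the
    cube [0, N]^I.  Its image averages over the heights t = 1, .., N the
    vertices assigned to the superlevel sets of y.  These sets form a flag, which
    makes this a point of the realization; it is the affine extension of phi to
    the barycentric subdivision. *)
Definition levels (eps : signs) (y : point) (x : P) : {set 'I_N} :=
  [set t : 'I_N | phi eps (superlevel t.+1 y) == x].

Definition sphere_point (eps : signs) (y : point) : P -> R :=
  fun x => #|levels eps y x|%:R / N%:R.

Lemma superlevel_le a b (y : point) :
  (a <= b)%N -> superlevel b y \subset superlevel a y.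
Proof. by move=> ab; apply/subsetP=> i; rewrite !inE; apply: leq_trans. Qed.

Lemma superlevel_neq0 a (y : point) i : (a <= y i)%N -> superlevel a y != set0.
Proof. by move=> ay; apply/set0Pn; exists i; rewrite inE. Qed.

Lemma sphere_point_supp eps y x : sphere_point eps y x != 0 ->
  exists t : 'I_N, x = phi eps (superlevel t.+1 y).
Proof.
rewrite /sphere_point mulf_eq0 negb_or pnatr_eq0 cards_eq0 => /andP[/set0Pn[t]].
by rewrite inE => /eqP <-; exists t.
Qed.

Lemma sphere_point_gt0 eps y : 0 < sphere_point eps y (phi eps (superlevel N y)).
Proof.
rewrite /sphere_point divr_gt0 ?ltr0n // card_gt0; apply/set0Pn.
have N1 : (N.-1 < N)%N by rewrite prednK.
by exists (Ordinal N1); rewrite inE /= prednK.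
Qed.

Lemma sphere_point_in eps (y : point) i : (N <= y i)%N ->
  realization P R (sphere_point eps y).
Proof.
move=> Ny; split=> [x||x x'].
- by rewrite divr_ge0.
- rewrite -mulr_suml -natr_sum.
  suff -> : (\sum_(x : P) #|levels eps y x| = N)%N.
    by rewrite divff // pnatr_eq0 -lt0n.
  rewrite -[RHS]card_ord -sum1_card.
  rewrite (partition_big (fun t : 'I_N => phi eps (superlevel t.+1 y)) xpredT) //=.
  by apply: eq_bigr => x _; rewrite -sum1_card; apply: eq_bigl => t; rewrite inE.
move=> /sphere_point_supp[t ->] /sphere_point_supp[t' ->].
wlog tt' : t t' / (t <= t')%N => [hw|].
  by have [|/ltnW] := leqP t t' => /hw //; rewrite comparable_sym.
rewrite comparable_sym le_comparable //; apply: (octa_le octa_phi).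
  by apply: (superlevel_neq0 (i := i)); apply: leq_trans Ny.
exact: superlevel_le.
Qed.

(** When y grows to y' by at most one in each coordinate, the superlevel sets can
    change only at the heights that are among the n+1 coordinates of y'. *)
Lemma sphere_point_close eps (y y' : point) x :
  (forall i, y i <= y' i <= (y i).+1)%N ->
  `|sphere_point eps y x - sphere_point eps y' x| <= n.+1%:R / N%:R.
Proof.
move=> yy'.
(* Heights are shifted by one: t : 'I_N stands for the height t + 1. *)
pose D := [set t : 'I_N | [exists i, y' i == t.+1]].
have cardD : (#|D| <= n.+1)%N.
  have [t0|t0] := altP (@forallP _ (fun t : 'I_N => t \notin D)).
    rewrite (_ : D = set0) ?cards0 //.
    by apply/setP=> t; rewrite [RHS]inE; apply/negbTE.
  pose f i : 'I_N := insubd (Ordinal N_gt0) (y' i).-1.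
  rewrite -[leqRHS](card_ord n.+1) -[leqRHS]cardsT.
  apply: leq_trans (leq_imset_card f _); apply: subset_leq_card.
  apply/subsetP=> t; rewrite inE => /existsP[i /eqP yi].
  apply/imsetP; exists i => //.
  by apply: val_inj; rewrite val_insubd yi /= ltn_ord.
have sup_eq t : t \notin D -> superlevel t.+1 y = superlevel t.+1 y'.
  rewrite inE => /existsPn tD; apply/setP=> i; rewrite !inE.
  have /andP[le1 le2] := yy' i.
  apply/idP/idP => [ty|ty']; first exact: leq_trans le1.
  by rewrite -ltnS; apply: leq_trans le2; rewrite ltn_neqAle ty' eq_sym tD.
have diff (z z' : point) :
    (forall t, t \notin D -> superlevel t.+1 z = superlevel t.+1 z') ->
    (#|levels eps z x| <= #|levels eps z' x| + n.+1)%N.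
  move=> zz'; apply: leq_trans (leq_add (leqnn _) cardD).
  apply: leq_trans (leq_card_setU _ _); apply: subset_leq_card.
  apply/subsetP=> t zt; rewrite in_setU.
  have [//|tD] := boolP (t \in D); rewrite ?orbT // orbF.
  by move: zt; rewrite !inE zz'.
rewrite -mulrBl normrM [`|N%:R^-1|]ger0_norm ?invr_ge0 //.
rewrite ler_wpM2r ?invr_ge0 //.
rewrite ler_distl lerBlDr -!natrD !ler_nat !diff // => t tD.
by rewrite sup_eq.
Qed.

Lemma sphere_point_flip eps (y : point) i : y i = 0%N ->
  sphere_point (flip i eps) y = sphere_point eps y.
Proof.
move=> yi0; apply/funext => x; congr (_%:R / _); apply: eq_card => t.
rewrite !inE; congr (_ == x); apply: (octa_local octa_phi) => j.
by rewrite inE ffunE => tj; case: eqVneq tj => [->|_]; rewrite ?yi0 ?addbF.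
Qed.

End SpherePoint.

Section NotContractible.
Local Open Scope ring_scope.
Variables (R : realType) (n : nat) (d : Order.disp_t) (P : finPOrderType d).
Local Notation I := 'I_n.+1.
Local Notation signs := {ffun I -> bool}.
Local Notation point := {ffun I -> nat}.

Lemma large_coordinate f : realization P R f -> exists x, #|P|%:R^-1 <= f x.
Proof.
move=> [f_ge0 f_sum _]; apply/not_existsP => f_lt.
have P_gt0 : (0 < #|P|)%N.
  rewrite lt0n; apply: contra_eq_neq f_sum => P0.
  rewrite big_pred0 1?eq_sym ?oner_eq0 // => x.
  by have := card0_eq P0 x; rewrite inE.
suff : \sum_(x : P) f x < \sum_(x : P) #|P|%:R^-1 :> R.
  rewrite f_sum sumr_const -(mulr_natr #|P|%:R^-1).
  by rewrite mulVf ?ltxx // pnatr_eq0 -lt0n.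
apply: ltr_sum => [|x _]; last by rewrite ltNge; apply/negP/f_lt.
by rewrite has_predT -[index_enum P]enumT -cardE.
Qed.

(** The shell of grid points of height between N and 2N is used to run the
    contraction, from the sphere at height 2N to the end point x0 at height N;
    the inner half of the ball is sent to x0.  On the outer boundary the label
    is that of the face where y is at least N, so that [octahedral_sperner]
    applies; inside it is any element with barycentric coordinate at least
    1/#|P|.  The choice of N makes the images of neighbouring grid points closer
    than that, so that the label of an inner point is in the support of the image
    of each of its neighbours. *)
Lemma octahedron_not_contractible (phi : signs -> {set I} -> P) :
  octahedron phi -> ~ contractible R (realization P R).
Proof.
move=> octa_phi [x0 [h [Ax0 ch hA h0 h1]]].
set A := realization P R in Ax0 ch hA h0 h1.
have cK := compact_setX (@compact_realization R d P) (@segment_compact R 0 1).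
have P_gt0 : (0 < #|P|)%N by apply/card_gt0P; exists (phi (positive n) setT).
have e_gt0 : 0 < #|P|%:R^-1 :> R by rewrite invr_gt0 ltr0n.
have [dl dl_gt0 h_close] := compact_unif_continuous cK ch e_gt0.
pose N := Num.bound (n.+1%:R / dl).
have N_large : n.+1%:R / dl < N%:R.
  by apply: archi_boundP; rewrite divr_ge0 // ltW.
have N_gt0 : (0 < N)%N.
  by rewrite -(ltr0n R); apply: le_lt_trans N_large; rewrite divr_ge0 // ltW.
have nN_dl : n.+1%:R / N%:R <= dl.
  by rewrite ler_pdivrMr ?ltr0n // mulrC -ler_pdivrMr // ltW.
have N_dl : 1 / N%:R <= dl.
  by apply: le_trans nN_dl; rewrite ler_wpM2r ?invr_ge0 // ler1n.
pose height (y : point) := (\max_i y i)%N.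
pose param y : R := (N.*2 - height y)%:R / N%:R.
pose H (eps : signs) (y : point) : P -> R :=
  if (height y < N)%N then x0 else h (sphere_point R phi N eps y, param y).
pose label (eps : signs) (y : point) : P :=
  if [exists i, y i == N.*2] then phi eps (superlevel N y)
  else odflt (phi (positive n) setT) [pick x | #|P|%:R^-1 <= H eps y x].
have param_itv y : (N <= height y)%N -> 0 <= param y <= 1.
  move=> Ny; rewrite divr_ge0 //= ler_pdivrMr ?ltr0n // mul1r ler_nat.
  by rewrite leq_subLR -addnn leq_add2r.
have height_arg y : exists i, height y = y i.
  have I_gt0 : (0 < #|I|)%N by rewrite card_ord.
  by have [i yi] := bigop.eq_bigmax (fun i => y i) I_gt0; exists i.
have sphere_in eps y : (N <= height y)%N -> A (sphere_point R phi N eps y).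
  by have [i ->] := height_arg y; apply: sphere_point_in.
have H_in eps y : A (H eps y).
  rewrite /H; case: ltnP => // Ny; apply: hA; first exact: sphere_in.
  exact: param_itv.
have height_ge (y : point) i : (y i <= height y)%N.
  exact: (bigop.leq_bigmax (F := fun i => y i)).
have H_close eps (y y' : point) x : (forall i, y i <= y' i <= (y i).+1)%N ->
    `|H eps y x - H eps y' x| < #|P|%:R^-1.
  move=> yy'.
  have le1 : (height y <= height y')%N.
    have [i ->] := height_arg y; apply: leq_trans (height_ge y' i).
    by have /andP[] := yy' i.
  have le2 : (height y' <= (height y).+1)%N.
    have [i ->] := height_arg y'; have /andP[_ /leq_trans->//] := yy' i.
    by rewrite ltnS height_ge.
  rewrite /H; case: (ltnP (height y')) => [lt'|ge'].
    by rewrite (leq_ltn_trans le1 lt') subrr normr0.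
  case: ltnP => [lt|ge].
    have -> : param y' = 1.
      have -> : param y' = (N.*2 - N)%:R / N%:R.
        congr (_%:R / _); congr (_ - _)%N; apply/eqP.
        by rewrite eqn_leq ge' (leq_trans le2).
      by rewrite -addnn addnK divff // pnatr_eq0 -lt0n.
    by rewrite h1 ?subrr ?normr0 //; exact: sphere_in.
  have inK z : (N <= height z)%N ->
      (realization P R `*` `[0, 1])%classic
        (sphere_point R phi N eps z, param z).
    move=> Nz; split; first exact: sphere_in.
    by rewrite /= in_itv /=; exact: param_itv.
  apply: h_close; [exact: inK | exact: inK | |] => /= [x'|].
    by apply: le_trans nN_dl; apply: sphere_point_close.
  apply: le_trans N_dl; rewrite -mulrBl normrM [`|N%:R^-1|]ger0_norm ?invr_ge0 //.
  rewrite ler_wpM2r ?invr_ge0 // ler_distl lerBlDr -!(natrD _ _ 1).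
  rewrite !ler_nat !addn1.
  rewrite leqW ?leq_sub2l //= leq_subLR addnS -addSn.
  by apply: leq_trans (leq_add le2 (leqnn _)); rewrite -leq_subLR.
have M1 : (N.*2.-1).+1 = N.*2 by rewrite prednK // double_gt0.
apply: (@octahedral_sperner n d P phi octa_phi N.*2.-1 N label).
- by rewrite M1 N_gt0 -addnn leq_addr.
- move=> eps y i yi0; rewrite /label /H (sphere_point_flip R octa_phi N eps yi0).
  case: ifP => // _; apply: (octa_local octa_phi) => j.
  rewrite inE ffunE; case: (eqVneq j i) => [->|_]; last by rewrite addbF.
  by rewrite yi0 leqNgt N_gt0.
- move=> eps y i; rewrite M1 => yi; rewrite /label ifT //.
  by apply/existsP; exists i; rewrite yi.
move=> eps y y' yy'; rewrite M1 => y'_le.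
pose top y := [exists i, (y : point) i == N.*2].
have label_large z : ~~ top z -> #|P|%:R^-1 <= H eps z (label eps z).
  move=> /negPf z_top; rewrite /label -/(top z) z_top; case: pickP => // none.
  by have [x] := large_coordinate (H_in eps z); rewrite none.
have label_supp (z : point) :
    (forall i, z i <= N.*2)%N -> H eps z (label eps z) != 0.
  move=> z_le; have [z_top|/label_large] := boolP (top z); last first.
    by move=> /(lt_le_trans e_gt0) /lt0r_neq0.
  have zN : height z = N.*2.
    have [i zi] := height_arg z; apply/eqP; rewrite eqn_leq {1}zi z_le /=.
    by have /existsP[j /eqP <-] := z_top; rewrite height_ge.
  have Nz : (N <= height z)%N by rewrite zN -addnn leq_addr.
  rewrite /label -/(top z) z_top /H ltnNge Nz /= /param zN subnn mul0r.
  by rewrite h0 ?lt0r_neq0 ?sphere_point_gt0 //; exact: sphere_in.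
have y_le i : (y i <= N.*2)%N.
  by apply: leq_trans (y'_le i); have /andP[] := yy' i.
have supp_comp z a b :
    H eps z a != 0 -> H eps z b != 0 -> (a >=< b)%O.
  by have [_ _] := H_in eps z; apply.
have [y'_top|/label_large y'_lab] := boolP (top y'); last first.
  apply: (supp_comp y); first exact: label_supp.
  rewrite lt0r_neq0 //; have := H_close eps y y' (label eps y') yy'.
  by rewrite ltr_distl => /andP[+ _]; apply: le_lt_trans; rewrite subr_ge0.
have [y_top|/label_large y_lab] := boolP (top y); last first.
  apply: (supp_comp y'); last exact: label_supp.
  rewrite lt0r_neq0 //; have := H_close eps y y' (label eps y) yy'.
  rewrite distrC ltr_distl => /andP[+ _]; apply: le_lt_trans.
  by rewrite subr_ge0.
rewrite /label -/(top y) y_top -/(top y') y'_top le_comparable //.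
apply: (octa_le octa_phi).
  have /existsP[i /eqP yi] := y_top; apply: (superlevel_neq0 (i := i)).
  by rewrite yi -addnn leq_addr.
apply/subsetP=> i; rewrite !inE => /leq_trans; apply.
by have /andP[] := yy' i.
Qed.

End NotContractible.

(** * Commuting perturbations of a basis *)

Section GroupBasis.
Local Open Scope group_scope.
Variables (gT : finGroupType) (p r : nat) (e : 'I_r -> gT) (E : {group gT}).
Hypothesis p_prime : prime p.
Hypothesis E_abelem : p.-abelem E.
Hypothesis E_card : #|E| = (p ^ r)%N.
Hypothesis E_gen : E = <<[set e i | i : 'I_r]>> :> {set gT}.

Definition subspan (A : {set 'I_r}) : {group gT} := <<[set e i | i in A]>>%G.

Lemma subspanT : subspan setT = E.
Proof.
apply: val_inj; rewrite /= E_gen; congr <<_>>.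
by apply/setP=> x; apply/imsetP/imsetP => -[i _ ->]; exists i; rewrite ?inE.
Qed.

Lemma subspanS (A B : {set 'I_r}) : A \subset B -> subspan A \subset subspan B.
Proof. by move=> AB; apply: genS; apply: imsetS. Qed.

Lemma subspan_sub (A : {set 'I_r}) : subspan A \subset E.
Proof. by rewrite -subspanT subspanS ?subsetT. Qed.

Lemma mem_subspan (A : {set 'I_r}) i : i \in A -> e i \in subspan A.
Proof. by move=> iA; apply: mem_gen; apply: imset_f. Qed.

Lemma subspanU A B : subspan (A :|: B) = (subspan A * subspan B)%g :> {set gT}.
Proof.
rewrite -[RHS]cent_joinEr; first by rewrite /= imsetU -joingE joing_idl joing_idr.
apply: sub_abelian_cent2 (subspan_sub _) (subspan_sub _).
exact: abelem_abelian E_abelem.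
Qed.

(** Each generator multiplies the order by at most p, and E is the product of
    the subspans of A and of its complement, so there is no loss. *)
Lemma card_subspan A : #|subspan A| = (p ^ #|A|)%N.
Proof.
have upper : forall k (B : {set 'I_r}), #|B| = k -> (#|subspan B| <= p ^ k)%N.
  elim=> [B /eqP|k IHk B Bk].
    by rewrite cards_eq0 => /eqP->; rewrite /subspan /= imset0 gen0 cards1.
  have /card_gt0P[i iB] : (0 < #|B|)%N by rewrite Bk.
  rewrite -(setD1K iB) subspanU.
  have := mul_cardG (subspan [set i]) (subspan (B :\ i)).
  move=> eq_card.
  apply: leq_trans (_ : #|subspan [set i]| * #|subspan (B :\ i)| <= _)%N.
    by rewrite eq_card leq_pmulr // cardG_gt0.
  rewrite expnS leq_mul //.
    rewrite /subspan /= imset_set1 -/(cycle _) -orderE dvdn_leq ?prime_gt0 //.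
    have [_ exp_p] := (abelemP p_prime E_abelem).
    by rewrite order_dvdn exp_p // -subspanT mem_subspan ?inE.
  by apply: IHk; have := cardsD1 i B; rewrite iB Bk add1n => -[<-].
apply/eqP; rewrite eqn_leq upper //=.
have := mul_cardG (subspan A) (subspan (~: A)).
rewrite -subspanU setUCr subspanT E_card => eq_card.
rewrite -(leq_pmul2r (m := p ^ #|~: A|)) ?expn_gt0 ?prime_gt0 //.
rewrite -expnD cardsC card_ord.
apply: leq_trans (leq_mul (leqnn _) (upper _ _ (erefl _))).
by rewrite eq_card leq_pmulr // cardG_gt0.
Qed.

Lemma subspanI A B : subspan (A :&: B) = (subspan A :&: subspan B)%G.
Proof.
apply/eqP; rewrite -val_eqE /= eqEcard subsetI !subspanS ?subsetIl ?subsetIr //=.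
have := mul_cardG (subspan A) (subspan B).
rewrite -subspanU !card_subspan => eq_card.
rewrite -(leq_pmul2l (m := p ^ #|A :|: B|)) ?expn_gt0 ?prime_gt0 // -eq_card.
by rewrite -!expnD cardsUI.
Qed.

Lemma subspan_inj A B : subspan A = subspan B -> A = B.
Proof.
move=> eqAB; apply/eqP; rewrite eqEcard.
have card_eq : #|A| = #|B|.
  by apply: (@expnI p); rewrite ?prime_gt1 // -!card_subspan eqAB.
rewrite card_eq leqnn andbT.
apply/setIidPl/eqP; rewrite eqEcard subsetIl /= card_eq.
rewrite -(leq_exp2l (m := p)) ?prime_gt1 // -!card_subspan.
by rewrite subspanI eqAB /= setIid.
Qed.

Variable c : 'I_r -> gT.
Hypothesis c_cent : forall i, c i \in 'C(subspan [set~ i]).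
Hypothesis c_norm : forall i, c i \notin 'N(<[e i]>).
Hypothesis c_comm : forall i j, commute (c i) (c j).

Lemma cent_other i j : i != j -> commute (c i) (e j).
Proof.
by move=> ij; apply: (centP (c_cent i)); apply: mem_subspan; rewrite !inE eq_sym.
Qed.

(** The centraliser contains a subgroup of index p and is not E, as c k would
    otherwise fix e k. *)
Lemma cent_basis k : 'C_E[c k] = subspan [set~ k].
Proof.
apply/esym/eqP; rewrite eqEcard subsetI subspan_sub sub_cent1 c_cent /=.
have C_lt : #|'C_E[c k]| < #|E|.
  apply: proper_card; rewrite properE subsetIl /=.
  apply: contra (c_norm k) => /subsetIP[_ EC].
  apply: (subsetP (cent_sub _)); rewrite cent_cycle.
  apply/cent1P/commute_sym/cent1P.
  by apply: (subsetP EC); rewrite -subspanT mem_subspan ?inE.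
have /(dvdn_pfactor _ _ p_prime)[m m_r Cm] : #|'C_E[c k]| %| p ^ r.
  by rewrite -E_card cardSg // subsetIl.
rewrite card_subspan cardsC1 card_ord Cm leq_exp2l ?prime_gt1 // -ltnS.
rewrite prednK; last by apply: leq_ltn_trans (ltn_ord k).
by rewrite -(ltn_exp2l (m := p)) ?prime_gt1 // -Cm -E_card.
Qed.

(** If the conjugate were in E, it would be centralised by c k for every k
    distinct from i, as both e i and c i are; so it would lie in the
    intersection of the corresponding hyperplanes, which is <[e i]>. *)
Lemma conj_notin i : e i ^ c i \notin E.
Proof.
apply: contra (c_norm i) => ecE.
have in_other k : k != i -> e i ^ c i \in subspan [set~ k].
  move=> ki; rewrite -cent_basis inE ecE; apply/cent1P; apply: commute_sym.
  rewrite conjgE; apply: commuteM; first exact: commuteV.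
  by apply: commuteM => //; exact: cent_other.
have : e i ^ c i \in subspan (\bigcap_(k | k != i) [set~ k]).
  elim/big_rec: _ => [|k S ki IHS]; first by rewrite subspanT.
  by rewrite subspanI inE in_other.
have -> : \bigcap_(k | k != i) [set~ k] = [set i].
  apply/setP=> j; rewrite inE; apply/bigcapP/eqP => [in_j|-> k].
    by apply: contraTeq isT => ji; have := in_j j ji; rewrite !inE eqxx.
  by rewrite !inE eq_sym.
rewrite /subspan /= imset_set1 => ec_cycle.
by apply/normP/eqP; rewrite eqEcard cardJg leqnn andbT -cycleJ cycle_subG.
Qed.

Local Notation signs := {ffun 'I_r -> bool}.

Definition vertex (eps : signs) i : gT := if eps i then e i ^ c i else e i.

Definition face (eps : signs) (A : {set 'I_r}) : {group gT} :=
  <<[set vertex eps i | i in A]>>%G.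

Definition twist (eps : signs) : gT := \prod_(i | eps i) c i.

Lemma conj_prod (s : seq 'I_r) (eps : signs) i : uniq s ->
  e i ^ (\prod_(j <- s | eps j) c j) =
  if (i \in s) && eps i then e i ^ c i else e i.
Proof.
elim: s => [|j s IHs] /=; first by rewrite big_nil conjg1.
move=> /andP[j_s /IHs{IHs}]; set tail := \prod_(k <- s | eps k) c k => IHs.
have c_tail : commute (c j) tail.
  rewrite /tail; elim/big_rec: _ => [|k x _ cx]; first exact: commute1.
  exact: commuteM.
rewrite big_cons -/tail inE; case eps_j: (eps j); last first.
  by rewrite IHs; case: eqVneq => [->|]; rewrite ?eps_j ?andbF.
have [ij|ij] := eqVneq i j.
  by rewrite c_tail conjgM IHs ij (negPf j_s) eps_j.
rewrite conjgM -IHs; congr (_ ^ _).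
by rewrite conjgE -(cent_other (i := j)) 1?eq_sym // mulKg.
Qed.

Lemma face_conj eps A : face eps A = (subspan A :^ twist eps)%G.
Proof.
apply: val_inj; rewrite /= -genJ; congr <<_>>.
rewrite -[RHS]imset_comp; apply: eq_imset => i.
rewrite /= /vertex /twist -[index_enum _]enumT.
by rewrite conj_prod ?enum_uniq // mem_enum.
Qed.

End GroupBasis.

(** * An octahedral sphere in the poset of elementary abelian subgroups *)

Section ApOctahedron.
Local Open Scope group_scope.
Variables (gT : finGroupType) (p n : nat) (G : {group gT}) (E : Ap p G).
Variable e : 'I_n.+1 -> gT.
Hypothesis p_prime : prime p.
Hypothesis E_max : forall F : Ap p G, (E <= F)%O -> F = E.
Hypothesis E_card : #|E| = (p ^ n.+1)%N.
Hypothesis E_gen : E = <<[set e i | i : 'I_n.+1]>> :> {set gT}.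
Variable c : 'I_n.+1 -> gT.
Hypothesis c_G : forall i, c i \in G.
Hypothesis c_cent : forall i, c i \in 'C(subspan e [set~ i]).
Hypothesis c_norm : forall i, c i \notin 'N(<[e i]>).
Hypothesis c_comm : forall i j, commute (c i) (c j).
Local Notation signs := {ffun 'I_n.+1 -> bool}.

Lemma Ap_abelem (F : Ap p G) : p.-abelem F.
Proof. by have /andP[/pElemP[]] := valP F. Qed.

Lemma Ap_sub (F : Ap p G) : F \subset G.
Proof. by have /andP[/pElemP[]] := valP F. Qed.

Let E_abelem := Ap_abelem E.

Lemma card_face eps A : #|face e c eps A| = (p ^ #|A|)%N.
Proof.
by rewrite (face_conj c_cent c_comm) cardJg (card_subspan p_prime E_abelem).
Qed.

(** The empty set of vertices generates the trivial group, which is not in the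
    poset; E is then a dummy value. *)
Definition Ap_face (eps : signs) (A : {set 'I_n.+1}) : Ap p G :=
  insubd E (face e c eps A).

Lemma val_Ap_face eps (A : {set 'I_n.+1}) : A != set0 ->
  Ap_face eps A = face e c eps A :> {group gT}.
Proof.
move=> A0; apply: insubdK; rewrite unfold_in /=; apply/andP; split.
  apply/pElemP; rewrite (face_conj c_cent c_comm) abelemJ; split.
    rewrite conj_subG ?(subset_trans (subspan_sub E_gen _)) ?Ap_sub //.
    by apply: group_prod => i _.
  exact: abelemS (subspan_sub E_gen _) E_abelem.
rewrite trivg_card1 card_face -(expn0 p) eqn_exp2l ?prime_gt1 //.
by rewrite cards_eq0.
Qed.

Lemma face_positive A : face e c (positive n) A = subspan e A.
Proof.
by apply: val_inj; congr <<_>>; apply: eq_imset => i; rewrite /vertex ffunE.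
Qed.

(** That the flag is a maximal chain comes down to orders: an F comparable with
    E lies in E, has order p^k for some k in 1, .., n+1, and is comparable with
    the member of the flag of the same order. *)
Lemma Ap_face_octahedron : octahedron Ap_face.
Proof.
have sT : [set: 'I_n.+1] != set0 by apply/set0Pn; exists ord0.
have faceT : Ap_face (positive n) setT = E.
  by apply: val_inj; rewrite /= val_Ap_face // face_positive (subspanT E_gen).
split.
- move=> eps A B A0 AB; have B0 : B != set0.
    by apply: contraNneq A0 => B0; move: AB; rewrite B0 properE sub0set andbF.
  rewrite lt_neqAle; apply/andP; split.
    apply: contraTneq (proper_card AB) => /(congr1 (fun F : Ap p G => #|F|)) /=.
    rewrite !val_Ap_face // !card_face => /(expnI (prime_gt1 p_prime))->.
    by rewrite ltnn.
  rewrite /Order.le /= /Ap_le !val_Ap_face //; apply: genS; apply: imsetS.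
  exact: proper_sub.
- move=> eps eps' A eqA; congr (insubd E _); apply: val_inj; congr <<_>>.
  by apply: eq_in_imset => i iA; rewrite /vertex eqA.
- move=> eps; rewrite faceT => eqE; apply/ffunP=> i; rewrite [RHS]ffunE.
  have ec_E := conj_notin p_prime E_abelem E_card E_gen c_cent c_norm c_comm i.
  apply: contraNF ec_E => eps_i.
  rewrite -eqE val_Ap_face //.
  by apply: mem_gen; apply/imsetP; exists i => //; rewrite /vertex eps_i.
- move=> A B; rewrite !inE => A0 B0.
  move=> /(congr1 (fun F : Ap p G => F : {group gT})) /=.
  rewrite !val_Ap_face // !face_positive.
  exact: (subspan_inj p_prime E_abelem E_card E_gen).
move=> F F_comp.
have init_face k : (0 < k <= n.+1)%N ->
    Ap_face (positive n) (initial n k) = subspan e (initial n k) :> {group gT}.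
  by move=> /andP[k0 _]; rewrite val_Ap_face ?initial_neq0 // face_positive.
have FE : F \subset E.
  have := F_comp n.+1; rewrite ltnS leqnn => /(_ isT).
  have -> : initial n n.+1 = setT by apply/setP=> i; rewrite !inE ltn_ord.
  by rewrite faceT => /orP[//|/E_max->].
have /(dvdn_pfactor _ _ p_prime)[k k_n F_card] : #|F| %| p ^ n.+1.
  by rewrite -E_card cardSg.
have k_gt0 : (0 < k)%N.
  rewrite lt0n; apply/eqP => k0; have /andP[_ /eqP] := valP F; apply; apply/eqP.
  by rewrite trivg_card1 F_card k0.
have k_n' : (0 < k <= n.+1)%N by rewrite k_gt0.
exists k => //; apply/val_inj/val_inj/eqP; rewrite /= init_face //.
have card_eq : #|F| = #|subspan e (initial n k)|.
  by rewrite (card_subspan p_prime E_abelem) // F_card card_initial.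
have := F_comp k k_n'; rewrite /Order.comparable /Order.le /= /Ap_le init_face //.
by case/orP => sub; [|rewrite eq_sym]; rewrite eqEcard sub card_eq leqnn.
Qed.

End ApOctahedron.

Local Open Scope group_scope.

Theorem theorem3p5 (R : realType) (gT : finGroupType) (G : {group gT})
    (p : nat) (p_prime : prime p) (p_dvd_G : p %| #|G|)
    (r : nat) (e : 'I_r -> gT) (E : Ap p G)
    (E_max : forall F : Ap p G, (E <= F)%O -> F = E)
    (E_rank : #|E| = (p ^ r)%N)
    (E_gen : E = <<[set e i | i : 'I_r]>> :> {set gT})
    (c : 'I_r -> gT)
    (c_in : forall i : 'I_r,
       c i \in 'C_G(<<[set e j | j : 'I_r & j != i]>>) :\: 'N_G(<[e i]>))
    (c_comm : forall i j : 'I_r, [~ c i, c j] = 1) :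
  [/\ reduced_homology_pred_neq0 (Ap p G) r,
      quillen_conjecture_at p G R
    & (r = 'r_p(G) -> quillen_dimension_at p G)].
Proof.
case: r => [|n] in e E_rank E_gen c c_in c_comm *.
  by have /andP[_ /eqP[]] := valP E; apply/eqP; rewrite trivg_card1 E_rank.
have octa : octahedron (Ap_face E e c).
  have c_G i : c i \in G by have := c_in i; rewrite !inE => /and3P[].
  apply: Ap_face_octahedron => // i.
  - have := c_in i; rewrite !inE => /and3P[_ _]; congr (_ \in 'C(<<_>>)).
    by apply/setP=> x; apply/imsetP/imsetP => -[j];
       rewrite ?inE => ? ->; exists j; rewrite ?inE.
  - by have := c_in i; rewrite !inE c_G => /and3P[].
  by move=> j; apply/commgP; rewrite c_comm.
split.
- exact: octahedron_homology octa.
- by move/(octahedron_not_contractible octa).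
by rewrite /quillen_dimension_at => <-; exact: octahedron_homology octa.
Qed.
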